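(* Let $G_1=(V_1,b_1,m_1)$ and $G_2=(V_2,b_2,m_2)$ be connected, locally finite weighted graphs with fixed vertices $x_1\in V_1$, $x_2\in V_2$. If $G_1$ has stronger average curvature growth outside of a finite set than $G_2$ (with respect to $x_1$, $x_2$), then there exists a constant $C>0$ such that $C\,m_1(S_r(x_1))\ge m_2(S_r(x_2))$ for every integer $r\ge 0$.
   Context: A weighted graph $G=(V,b,m)$ consists of a countable set $V$, a measure $m:V\to(0,\infty)$ (with $m(A)=\sum_{x\in A}m(x)$ for $A\subseteq V$), and a symmetric edge weight $b:V\times V\to[0,\infty)$ vanishing on the diagonal. Write $x\sim y$ if $b(x,y)>0$. The graph is locally finite if every vertex has finitely many neighbors, and connected if any two vertices are joined by a path $x_0\sim x_1\sim\dots\sim x_n$; $d(x,y)$ is the smallest number of edges of a path joining $x$ and $y$. For a fixed vertex $x_0$, $S_r(x_0)=\{x\in V: d(x,x_0)=r\}$. The outer and inner curvatures with respect to $x_0$ at $x\in S_r(x_0)$ are $$k_{\pm}(x)=\frac1{m(x)}\sum_{y\in S_{r\pm1}(x_0)}b(x,y),\qquad k_-(x_0)=0.$$ The averaging operator with respect to $x_0$ is $\mathcal{A}f(x)=\frac{1}{m(S_r(x_0))}\sum_{y\in S_r(x_0)}f(y)m(y)$ for $x\in S_r(x_0)$. Let $k^i_\pm$ and $\mathcal{A}_i$ be the curvatures and averaging operator of $G_i$ with respect to $x_i$. One says that $G_1$ has stronger average curvature growth outside of a finite set than $G_2$ if there is $R>0$ such that for all integers $r\ge R$ and all $x'\in S_r(x_1)$,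 $x''\in S_r(x_2)$, $$\mathcal{A}_1k^1_+(x')\ge \mathcal{A}_2k^2_+(x'')\quad\text{and}\quad \mathcal{A}_1k^1_-(x')\le\mathcal{A}_2k^2_-(x'').$$
   Formalization: V_1 is assumed infinite, so every sphere S_r(x_1) is nonempty; for finite V_1 the claim can fail: with V_1={x_1} and G_2 a single edge, the growth condition is vacuous for r≥1 but m_1(S_1(x_1))=0<m_2(S_1(x_2)). *)

(* Defs.v *)
From HB Require Import structures.
From mathcomp Require Import all_boot all_order all_algebra.
From mathcomp Require Import boolp classical_sets functions cardinality fsbigop.
From mathcomp Require Import reals ereal esum.

Set Implicit Arguments.
Unset Strict Implicit.
Unset Printing Implicit Defensive.

Import Order.TTheory GRing.Theory Num.Theory.

Local Open Scope classical_set_scope.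
Local Open Scope ring_scope.

Record weighted_graph (R : realType) (V : countType) := WeightedGraph {
  edge_weight : V -> V -> R;
  vertex_weight : V -> R;
  edge_weight_ge0 : forall x y, 0 <= edge_weight x y;
  edge_weight_sym : forall x y, edge_weight x y = edge_weight y x;
  edge_weight_diag : forall x, edge_weight x x = 0;
  vertex_weight_gt0 : forall x, 0 < vertex_weight x }.

Section WeightedGraphDefs.
Context {R : realType} {V : countType}.
Implicit Types (G : weighted_graph R V) (x y : V) (A : set V) (f : V -> R).

Definition graph_measure G A : \bar R :=
  (\esum_(x in A) (vertex_weight G x)%:E)%E.

Definition adj G : rel V := fun x y => 0 < edge_weight G x y.

Definition locally_finite G : Prop := forall x, finite_set [set y | adj G x y].

Definition joined_by G (n : nat) x y : Prop :=
  exists p : seq V, [/\ path (adj G) x p, last x p = y & size p = n].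

Definition graph_connected G : Prop := forall x y, exists n, joined_by G n x y.

(* The default value 0 is only taken when no path joins x and y. *)
Definition graph_dist G x y : nat :=
  xget 0%N [set n | joined_by G n x y /\
                    forall k, joined_by G k x y -> (n <= k)%N].

Definition sphere G (x0 : V) (r : nat) : set V :=
  [set x | graph_dist G x x0 = r].

(* The sums \sum_(y \in A) below have finite support when G is locally finite
   and connected: each vertex has finitely many neighbors, and spheres are
   finite. *)
Definition outer_curvature G (x0 x : V) : R :=
  (vertex_weight G x)^-1 *
  \sum_(y \in sphere G x0 (graph_dist G x x0).+1) edge_weight G x y.

Definition inner_curvature G (x0 x : V) : R :=
  if graph_dist G x x0 is r.+1 then
    (vertex_weight G x)^-1 * \sum_(y \in sphere G x0 r) edge_weight G x y
  else 0.

Definition averaging G (x0 : V) f (x : V) : R :=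
  let S := sphere G x0 (graph_dist G x x0) in
  (fine (graph_measure G S))^-1 * \sum_(y \in S) f y * vertex_weight G y.

End WeightedGraphDefs.

Definition stronger_average_curvature_growth (R : realType)
    (V1 V2 : countType) (G1 : weighted_graph R V1) (G2 : weighted_graph R V2)
    (x1 : V1) (x2 : V2) : Prop :=
  exists2 R0 : R, 0 < R0 &
    forall r : nat, R0 <= r%:R ->
    forall x' x'', sphere G1 x1 r x' -> sphere G2 x2 r x'' ->
      averaging G2 x2 (outer_curvature G2 x2) x''
        <= averaging G1 x1 (outer_curvature G1 x1) x' /\
      averaging G1 x1 (inner_curvature G1 x1) x'
        <= averaging G2 x2 (inner_curvature G2 x2) x''.

(* Main.v *)
(** The measure of the edges between consecutive spheres, [cut r], equals both
    [m(S_r)] times the average of [k_+] on [S_r] and [m(S_{r+1})] times the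
    average of [k_-] on [S_{r+1}].  Hence [m(S_{r+1}) / m(S_r)] is the quotient
    of these two averages, so the curvature comparison makes the ratio
    [m_2(S_r) / m_1(S_r)] nonincreasing for large [r]. *)
Require Import Defs.
From HB Require Import structures.
From mathcomp Require Import all_boot all_order all_algebra.
From mathcomp Require Import boolp classical_sets functions cardinality fsbigop.
From mathcomp Require Import reals ereal esum.

Set Implicit Arguments.
Unset Strict Implicit.
Unset Printing Implicit Defensive.

Import Order.TTheory GRing.Theory Num.Theory.

Local Open Scope classical_set_scope.
Local Open Scope ring_scope.

Lemma pfsumr_gt0 (R : realDomainType) (I : choiceType) (P : set I) (F : I -> R)
    (i : I) :
  finite_set P -> (forall j, P j -> 0 <= F j) -> P i -> 0 < F i ->
  0 < \sum_(j \in P) F j.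
Proof.
move=> finP F0 Pi Fi; rewrite lt_neqAle fsumr_ge0// andbT eq_sym.
by apply/eqP => /(pfsumr_eq0 finP F0) /(_ _ Pi) F_eq0; rewrite F_eq0 ltxx in Fi.
Qed.

Section Spheres.
Context {R : realType} {V : countType}.
Variables (G : weighted_graph R V) (x0 : V).
Hypotheses (G_connected : graph_connected G) (G_lf : locally_finite G).

Let mu := vertex_weight G.

(** Real-valued, so that quotients can be formed; [graph_measure_sphere] ties it to the
    extended-real measure. *)
Definition sphere_measure (r : nat) : R := \sum_(y \in sphere G x0 r) mu y.

Definition cut (r : nat) : R :=
  \sum_(x \in sphere G x0 r) \sum_(y \in sphere G x0 r.+1) edge_weight G x y.

Lemma joined_by_cons n x y z : adj G x y -> joined_by G n y z ->
  joined_by G n.+1 x z.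
Proof. by move=> xy [p [yp pz <-]]; exists (y :: p); split => //=; rewrite xy. Qed.

Lemma joined_byS n x z : joined_by G n.+1 x z ->
  exists2 y, adj G x y & joined_by G n y z.
Proof. by move=> [[|y p] []]//= /andP[xy yp] pz [pn]; exists y => //; exists p. Qed.

(** Connectedness provides some path length, hence a least one, so [xget] never returns its
    default. *)
Lemma graph_distP x y : joined_by G (graph_dist G x y) x y /\
  forall k, joined_by G k x y -> (graph_dist G x y <= k)%N.
Proof.
apply: (@xgetPex _ 0%N [set n | joined_by G n x y /\
  forall k, joined_by G k x y -> (n <= k)%N]).
have exP : exists n, `[< joined_by G n x y >].
  by have [n xy] := G_connected x y; exists n; apply/asboolP.
case: (ex_minnP exP) => n /asboolP xy n_min.
by exists n; split=> // k /asboolP; exact: n_min.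
Qed.

Lemma sphere0 : sphere G x0 0 `<=` [set x0].
Proof.
move=> x /= x_d; have [+ _] := graph_distP x x0.
by rewrite x_d => -[[|? ?] []].
Qed.

(** Take the first step of a shortest path to [x0]: if it landed any closer than [r], prepending [x]
    would give a path from [x] shorter than its distance. *)
Lemma sphere_pred r x : sphere G x0 r.+1 x ->
  exists2 y, sphere G x0 r y & adj G x y.
Proof.
move=> /= x_d; have [] := graph_distP x x0; rewrite x_d.
move=> /joined_byS[y xy /(graph_distP y x0).2 y_le] x_min.
exists y => //; apply/eqP; rewrite eqn_leq y_le/= -ltnS x_min//.
exact: joined_by_cons xy (graph_distP y x0).1.
Qed.

(** Induction on [r]: by [sphere_pred], the next sphere is covered by the finite neighbor sets of
    the finitely many points of the current one. *)
Lemma finite_sphere r : finite_set (sphere G x0 r).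
Proof.
elim: r => [|r IHr]; first exact: sub_finite_set sphere0 (finite_set1 x0).
have := @bigcup_finite _ _ _ (fun y => [set x | adj G y x]) IHr (fun y _ => G_lf y).
apply: sub_finite_set => x /sphere_pred[y yr xy]; exists y => //=.
by rewrite /adj edge_weight_sym.
Qed.

Lemma sphere_nonempty_le r s : (r <= s)%N -> sphere G x0 s !=set0 ->
  sphere G x0 r !=set0.
Proof.
elim: s => [|s IHs]; first by rewrite leqn0 => /eqP->.
rewrite leq_eqVlt => /predU1P[->//|r_s] [x /sphere_pred[y ys _]].
by apply: IHs => //; exists y.
Qed.

(** An empty sphere forces all later ones to be empty, and then the vertex set is a finite union of
    finite spheres. *)
Lemma infinite_sphere_nonempty r : infinite_set [set: V] ->
  sphere G x0 r !=set0.
Proof.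
move=> Vinf; apply/set0P/eqP => r_empty; apply: Vinf.
have := @bigcup_finite _ _ _ _ (finite_II r) (fun s _ => finite_sphere s).
apply: sub_finite_set => x _; exists (graph_dist G x x0) => //=.
rewrite ltnNge; apply/negP => /sphere_nonempty_le; rewrite r_empty.
by case; [exists x | move=> ? []].
Qed.

Lemma graph_measure_sphere r :
  graph_measure G (sphere G x0 r) = (sphere_measure r)%:E.
Proof.
rewrite /graph_measure esum_fset; last 2 first.
- exact: finite_sphere.
- by move=> x _; rewrite lee_fin ltW// vertex_weight_gt0.
by rewrite fsumEFin//; exact: finite_sphere.
Qed.

Lemma sphere_measure_ge0 r : 0 <= sphere_measure r.
Proof. by apply: fsumr_ge0 => x _; rewrite ltW// vertex_weight_gt0. Qed.

Lemma sphere_measure_gt0 r : sphere G x0 r !=set0 -> 0 < sphere_measure r.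
Proof.
move=> [x xr]; apply: (pfsumr_gt0 (finite_sphere r) _ xr) => [y _|].
- exact/ltW/vertex_weight_gt0.
- exact: vertex_weight_gt0.
Qed.

Lemma cut_gt0 r : sphere G x0 r.+1 !=set0 -> 0 < cut r.
Proof.
move=> [x xr]; have [y yr xy] := sphere_pred xr.
have b0 z u : 0 <= edge_weight G z u by exact: edge_weight_ge0.
apply: (pfsumr_gt0 (finite_sphere r) _ yr) => [z _|]; first exact: fsumr_ge0.
apply: (pfsumr_gt0 (finite_sphere r.+1) _ xr) => //.
by rewrite edge_weight_sym.
Qed.

Lemma averaging_sphere (f : V -> R) r x : sphere G x0 r x ->
  averaging G x0 f x = (\sum_(y \in sphere G x0 r) f y * mu y) / sphere_measure r.
Proof. by move=> /= xr; rewrite /averaging xr graph_measure_sphere mulrC. Qed.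

(** The weight [mu y] in the average cancels the factor [(mu y)^-1] in the curvature. *)
Lemma averaging_outer_curvature r x : sphere G x0 r x ->
  averaging G x0 (outer_curvature G x0) x = cut r / sphere_measure r.
Proof.
move=> xr; rewrite (averaging_sphere _ xr); congr (_ / _).
apply: eq_fsbigr => y /set_mem/= yr.
by rewrite /outer_curvature yr mulrAC mulVf ?mul1r// gt_eqF// vertex_weight_gt0.
Qed.

(** The same cancellation, after exchanging the two sums in [cut] and using the symmetry of the edge
    weight. *)
Lemma averaging_inner_curvature r x : sphere G x0 r.+1 x ->
  averaging G x0 (inner_curvature G x0) x = cut r / sphere_measure r.+1.
Proof.
move=> xr; rewrite (averaging_sphere _ xr); congr (_ / _).
rewrite /cut exchange_fsbig; [|exact: finite_sphere..].
apply: eq_fsbigr => y /set_mem/= yr.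
rewrite /inner_curvature yr mulrAC mulVf ?mul1r; last first.
  by rewrite gt_eqF// vertex_weight_gt0.
by apply: eq_fsbigr => z _; rewrite edge_weight_sym.
Qed.

End Spheres.

Theorem theorem3p13 (R : realType) (V1 V2 : countType)
    (G1 : weighted_graph R V1) (G2 : weighted_graph R V2)
    (x1 : V1) (x2 : V2)
    (V1_infinite : infinite_set [set: V1])
    (G1_connected : graph_connected G1) (G2_connected : graph_connected G2)
    (G1_locally_finite : locally_finite G1)
    (G2_locally_finite : locally_finite G2)
    (growth : stronger_average_curvature_growth G1 G2 x1 x2) :
  exists2 C : R, 0 < C &
    forall r : nat,
      (graph_measure G2 (sphere G2 x2 r)
        <= C%:E * graph_measure G1 (sphere G1 x1 r))%E.
Proof.
set m1 := sphere_measure G1 x1; set m2 := sphere_measure G2 x2.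
have S1 r : sphere G1 x1 r !=set0 by exact: infinite_sphere_nonempty.
have m1_gt0 r : 0 < m1 r by exact: sphere_measure_gt0.
have m2_ge0 r : 0 <= m2 r by exact: sphere_measure_ge0.
case: growth => R0 R0_gt0 growth.
(* Cross-multiplied form of the decrease of [m2 / m1] from [r] to [r.+1]. *)
have ratio_le r : R0 <= r%:R -> m2 r.+1 * m1 r <= m1 r.+1 * m2 r.
  (* [V2] may be finite; past its last nonempty sphere the left-hand side is 0. *)
  move=> R0r; have [S2|] := pselect (sphere G2 x2 r.+1 !=set0); last first.
    move=> /set0P/negP/negPn/eqP S2.
    rewrite {1}/m2 /sphere_measure S2 fsbig_set0 mul0r.
    by rewrite mulr_ge0// ltW.
  have S2r := sphere_nonempty_le G2_connected (leqnSn r) S2.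
  have c1 := cut_gt0 G1_connected G1_locally_finite (S1 r.+1).
  have c2 := cut_gt0 G2_connected G2_locally_finite S2.
  have m2r : 0 < m2 r by exact: sphere_measure_gt0.
  have m2r1 : 0 < m2 r.+1 by exact: sphere_measure_gt0.
  have [[y' y'r] [y'' y''r]] := (S1 r, S2r).
  have [[z' z'r] [z'' z''r]] := (S1 r.+1, S2).
  have R0r1 : R0 <= r.+1%:R by rewrite (le_trans R0r)// ler_nat.
  (* Outer curvatures are compared at [r] and inner ones at [r.+1], so that both involve the same
     [cut r] in each graph. *)
  have [+ _] := growth r R0r y' y'' y'r y''r.
  have [_ +] := growth r.+1 R0r1 z' z'' z'r z''r.
  rewrite (averaging_inner_curvature _ _ z'r)//.
  rewrite (averaging_inner_curvature _ _ z''r)//.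
  rewrite (averaging_outer_curvature _ _ y'r)//.
  rewrite (averaging_outer_curvature _ _ y''r)//.
  rewrite !ler_pdivrMr// !(mulrAC _ _^-1) !ler_pdivlMr// => inner outer.
  (* Multiplying [inner] by [outer] puts the product of the two cuts on both sides, where it
     cancels. *)
  rewrite -(ler_pM2l (mulr_gt0 c1 c2)).
  have := ler_pM (ltW (mulr_gt0 c1 m2r1)) (ltW (mulr_gt0 c2 (m1_gt0 r))) inner outer.
  rewrite -(mulrACA (cut _ _ _)) -/m1 -/m2 => /le_trans; apply.
  by rewrite [leLHS]mulrACA [X in X * _]mulrC.
have [N R0N] : exists N : nat, R0 <= N%:R.
  by exists (Num.truncn R0).+1; rewrite ltW// truncnS_gt.
(* The sum dominates each ratio with index at most [N], and the 1 makes positivity immediate. *)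
pose C := 1 + \sum_(i < N.+1) m2 i / m1 i.
have quot_ge0 i : 0 <= m2 i / m1 i by rewrite divr_ge0// ltW.
have C_gt0 : 0 < C by rewrite ltr_pwDl// sumr_ge0.
exists C => // r.
rewrite !graph_measure_sphere// -EFinM lee_fin -/m1 -/m2.
have small i : (i <= N)%N -> m2 i <= C * m1 i.
  move=> iN; rewrite -ler_pdivrMr// /C (bigD1 (Ordinal (iN : (i < N.+1)%N)))//=.
  rewrite addrCA lerDl addr_ge0// sumr_ge0//.
elim: r => [|r IHr]; first exact: small.
(* Up to [N] the choice of [C] suffices; beyond it, [ratio_le] carries the bound from [r] to
   [r.+1]. *)
have [/small//|Nr] := leqP r.+1 N.
have /ratio_le ratio_r : R0 <= r%:R by rewrite (le_trans R0N)// ler_nat -ltnS.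
rewrite -(ler_pM2r (m1_gt0 r)) (le_trans ratio_r)// mulrAC mulrC.
by rewrite ler_pM2r.
Qed.
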